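(* Let $r>0$ and let $\gamma:I\to\mathbb R^2$ be a regular $C^2$ plane curve, defined on an interval $I$ of positive length, whose curvature $\kappa$ is nowhere zero and whose radius of curvature $1/|\kappa|$ is at most $r$ at every point. Then any sufficiently short piece of the curve is contained in the boundary of some $r$-maximal subset of the plane: for every $t_0\in I$ there is a neighborhood $J$ of $t_0$ in $I$ such that $\gamma(J)\subset \mathrm{Bdry}(C)$ for some $r$-maximal subset $C$ of $\mathbb R^2$.
   Context: $\mathbb R^2$ has the usual Euclidean metric. A subset of $\mathbb R^2$ is $r$-bounded if its diameter is at most $r$; it is $r$-maximal if it is maximal (with respect to inclusion) among the $r$-bounded subsets of $\mathbb R^2$. $\mathrm{Bdry}(C)$ is the topological boundary of $C$. *)

(* Defs.v *)
From HB Require Import structures.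
From mathcomp Require Import all_boot all_order all_algebra.
From mathcomp Require Import all_classical all_reals all_analysis.

Set Implicit Arguments.
Unset Strict Implicit.
Unset Printing Implicit Defensive.

Import Order.TTheory GRing.Theory Num.Theory.
Import numFieldNormedType.Exports.

Local Open Scope classical_set_scope.
Local Open Scope ring_scope.

(* The plane is R * R.  The norm `|p| that the library puts on R * R is the sup
   norm, so the Euclidean norm is defined by hand; the product topology is the
   Euclidean one, so the library's closure and interior can be used. *)

Definition enorm (R : realType) (p : R * R) : R :=
  Num.sqrt (p.1 ^+ 2 + p.2 ^+ 2).

Definition edist (R : realType) (p q : R * R) : R := enorm (p - q).

(* Infinite on unbounded sets.  The supremum over the empty set is -oo rather
   than 0, so for r >= 0 the empty set is r-bounded, as it should be. *)
Definition ediam (R : realType) (A : set (R * R)) : \bar R :=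
  ereal_sup [set (edist p q)%:E | p in A & q in A].

Definition r_bounded (R : realType) (r : R) (A : set (R * R)) : Prop :=
  (ediam A <= r%:E)%E.

Definition r_maximal (R : realType) (r : R) (A : set (R * R)) : Prop :=
  r_bounded r A /\
  forall B : set (R * R), r_bounded r B -> A `<=` B -> B = A.

Definition Bdry (T : topologicalType) (A : set T) : set T :=
  closure A `\` interior A.

Definition positive_length (R : realType) (I : set R) : Prop :=
  exists a b : R, [/\ I a, I b & a < b].

(* Difference quotients are taken along points of I only, so that derivatives
   are one-sided at the endpoints of I belonging to I, and the values of f
   outside I are irrelevant. *)
Definition derivable_in (R : realType) (I : set R) (f : R -> R * R) (t : R) :
    Prop :=
  cvg ((s - t)^-1 *: (f s - f t) @[s --> within I t^']).

Definition derive_in (R : realType) (I : set R) (f : R -> R * R) (t : R) :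
    R * R :=
  lim ((s - t)^-1 *: (f s - f t) @[s --> within I t^']).

Definition C2_curve (R : realType) (I : set R) (g : R -> R * R) : Prop :=
  [/\ forall t, I t -> derivable_in I g t,
      forall t, I t -> derivable_in I (derive_in I g) t &
      {within I, continuous (derive_in I (derive_in I g))}].

Definition regular_curve (R : realType) (I : set R) (g : R -> R * R) : Prop :=
  forall t, I t -> derive_in I g t != 0.

(* Signed curvature (x' y'' - y' x'') / |g'|^3. *)
Definition curvature (R : realType) (I : set R) (g : R -> R * R) (t : R) : R :=
  let v := derive_in I g t in
  let a := derive_in I (derive_in I g) t in
  (v.1 * a.2 - v.2 * a.1) / enorm v ^+ 3.

(* Main.v *)
Require Import Defs.
From HB Require Import structures.
From mathcomp Require Import all_boot all_order all_algebra.
From mathcomp Require Import all_classical all_reals all_analysis.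
From mathcomp Require Import ring lra.

(** Write [v = gamma'], [a = gamma''], let [n] be the unit normal pointing
    towards the centre of curvature, and let [e t = gamma t + r n(t)] be the
    parallel curve at distance [r].  Differentiating the unit normal gives
    [e' = (1 - r |kappa|) v], so the hypothesis [1 / |kappa| <= r] says that [e]
    runs backwards along the tangents of [gamma].

    Every point [gamma t] is at distance exactly [r] from [e t].  If [A] is a
    set of diameter at most [r] that contains [gamma t] and [e t], then
    [gamma t] is not interior to [A], for moving it straight away from [e t]
    would create a distance larger than [r] ([diameter_end_Bdry]).  By
    Zorn's lemma every [r]-bounded set lies in an [r]-maximal one
    ([r_maximal_extension]).  It is therefore enough to find a
    neighborhood [J] of [t0] such that [gamma(J) U e(J)] is [r]-bounded.

    Distances inside [gamma(J)] and inside [e(J)] are small by continuity; the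
    mixed distances are the point.  Fix [s] and put
    [F t = |gamma s - e t| ^ 2], so that [F s = r ^ 2].  As
    [gamma s - e t] and [gamma s - gamma t] differ by a normal vector at [t],
    [F' t = 2 (r |kappa t| - 1) <gamma s - gamma t, v t>].  If the tangents to
    [gamma] over [J] make acute angles with each other, the mean value theorem
    gives [<gamma s - gamma t, v t>] the sign of [s - t]
    ([chord_dot_tangent]).  Hence [F] increases before [s] and decreases after
    it, and [F <= r ^ 2] ([edist_parallel_le]): near [t] the curve stays in the
    disc of radius [r] tangent to it at [gamma t], even when
    [r |kappa| = 1] and a second order expansion is inconclusive. *)

Set Implicit Arguments.
Unset Strict Implicit.
Unset Printing Implicit Defensive.

Import Order.TTheory GRing.Theory Num.Theory.
Import numFieldNormedType.Exports.

Local Open Scope classical_set_scope.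
Local Open Scope ring_scope.

(* Unqualified, this is the extended distance of pseudometric spaces. *)
Local Notation edist := Defs.edist.

(** * The Euclidean plane and sets of bounded diameter *)

Section EuclideanPlane.
Variable R : realType.
Implicit Types (p q u v w : R * R) (A B : set (R * R)).

Definition dot p q : R := p.1 * q.1 + p.2 * q.2.
Definition cross p q : R := p.1 * q.2 - p.2 * q.1.

Lemma crossvv p : cross p p = 0.
Proof. by rewrite /cross mulrC subrr. Qed.

Lemma dot_ge0 p : 0 <= dot p p.
Proof. by rewrite addr_ge0 // -expr2 sqr_ge0. Qed.

Lemma dot_gt0 p : p != 0 -> 0 < dot p p.
Proof.
move=> p_neq0; rewrite lt_neqAle dot_ge0 andbT eq_sym.
apply: contra p_neq0; rewrite /dot paddr_eq0 -?expr2 ?sqr_ge0 // !sqrf_eq0.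
by case: p => x y /=.
Qed.

Lemma enorm_ge0 p : 0 <= enorm p. Proof. exact: sqrtr_ge0. Qed.

Lemma enormE p : enorm p = Num.sqrt (dot p p).
Proof. by rewrite /enorm !expr2. Qed.

Lemma sqr_enorm p : enorm p ^+ 2 = dot p p.
Proof. by rewrite enormE sqr_sqrtr // dot_ge0. Qed.

Lemma enorm_gt0 p : p != 0 -> 0 < enorm p.
Proof. by move=> p_neq0; rewrite enormE sqrtr_gt0 dot_gt0. Qed.

Lemma enorm_le (d : R) p : 0 <= d -> (enorm p <= d) = (dot p p <= d ^+ 2).
Proof. by move=> d_ge0; rewrite -sqr_enorm ler_sqr ?nnegrE ?enorm_ge0. Qed.

Lemma enorm_eq (d : R) p : 0 <= d -> dot p p = d ^+ 2 -> enorm p = d.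
Proof. by move=> d_ge0 pd; rewrite enormE pd sqrtr_sqr ger0_norm. Qed.

Lemma enormZ (c : R) p : enorm (c *: p) = `|c| * enorm p.
Proof.
apply: enorm_eq; first by rewrite mulr_ge0 ?enorm_ge0.
rewrite exprMn sqr_enorm real_normK ?num_real // /dot /=.
by rewrite /GRing.scale /=; ring.
Qed.

Lemma edistC p q : edist p q = edist q p.
Proof. by rewrite /edist -opprB -scaleN1r enormZ normrN1 mul1r. Qed.

Lemma edist_le_small (e : R) p q c :
  `|p.1 - c.1| <= e -> `|p.2 - c.2| <= e ->
  `|q.1 - c.1| <= e -> `|q.2 - c.2| <= e -> edist p q <= 4 * e.
Proof.
move=> p1 p2 q1 q2; have e_ge0 : 0 <= e by exact: le_trans p1.
have sqr_le x y z : `|x - z| <= e -> `|y - z| <= e ->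
    (x - y) ^+ 2 <= (2 * e) ^+ 2.
  rewrite !ler_norml => /andP[? ?] /andP[? ?].
  rewrite -real_normK ?num_real // ler_sqr ?nnegrE ?mulr_ge0 // ler_norml.
  by apply/andP; split; lra.
have D1 := sqr_le _ _ _ p1 q1; have D2 := sqr_le _ _ _ p2 q2.
rewrite /edist enorm_le ?mulr_ge0 // /dot /=.
by have := sqr_ge0 e; move: D1 D2; rewrite !expr2; lra.
Qed.

(** Two vectors within an angle of [pi/4] from [w] make an angle of at most
    [pi/2].  Each hypothesis concerns a single vector and is true of all vectors
    close to [w], so it holds along a short piece of a curve of vectors. *)
Lemma dot_ge0_of_sector u v w :
  `|cross u w| <= dot u w -> `|cross v w| <= dot v w -> w != 0 ->
  0 <= dot u v.
Proof.
move=> uw vw /dot_gt0 ww; rewrite -(pmulr_rge0 _ ww).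
have -> : dot w w * dot u v = dot u w * dot v w + cross u w * cross v w.
  by rewrite /dot /cross; ring.
have : `|cross u w * cross v w| <= dot u w * dot v w.
  by rewrite normrM ler_pM.
by rewrite ler_norml; lra.
Qed.

Lemma r_boundedP (r : R) A :
  r_bounded r A <-> forall p q, A p -> A q -> edist p q <= r.
Proof.
split=> [bA p q Ap Aq|bA].
  rewrite -lee_fin; apply: le_trans bA; apply: ereal_sup_ubound.
  by exists p => //; exists q.
by apply: ge_ereal_sup => _ [p Ap [q Aq <-]]; rewrite lee_fin bA.
Qed.

(** Zorn's lemma: two points of the union of a chain lie in a single member. *)
Lemma r_maximal_extension (r : R) A :
  r_bounded r A -> exists C, r_maximal r C /\ A `<=` C.
Proof.
move=> bA.
(* Adding [A] to every member of a chain handles the empty chain too. *)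
pose P := [set X : set (R * R) | r_bounded r (X `|` A)].
have [F FP Ftot|M [PM Mmax]] := @Zorn_bigcup _ P.
  apply/r_boundedP => p q.
  have inF X x : F X -> (X `|` A) x -> ((\bigcup_(Y in F) Y) `|` A) x.
    by move=> FX [Xx|Ax]; [left; exists X|right].
  have bF X : F X -> forall x y, (X `|` A) x -> (X `|` A) y -> edist x y <= r.
    by move=> /FP /r_boundedP.
  move=> [[X FX Xp]|Ap] [[Y FY Yq]|Aq].
  - have [XY|YX] := Ftot _ _ FX FY.
      by apply: (bF _ FY); left => //; exact: XY.
    by apply: (bF _ FX); left => //; exact: YX.
  - by apply: (bF _ FX); [left|right].
  - by apply: (bF _ FY); [right|left].
  - by move/r_boundedP: bA; apply.
exists (M `|` A); split; last by right.
split=> // B bB MAB.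
apply/seteqP; split => // x Bx; left.
have PB : P B by rewrite /P /= setUidl // => y Ay; apply: MAB; right.
have MB : M `<=` B by move=> y My; apply: MAB; left.
by apply: contrapT => nMx; apply: (Mmax B) => //; split=> // /(_ _ Bx).
Qed.

(** Points [p + e (p - q)] with [e > 0] are at distance [(1 + e) r > r] from
    [q], hence outside [C], and they tend to [p] as [e] tends to [0]. *)
Lemma diameter_end_Bdry (r : R) (C : set (R * R)) p q :
  0 < r -> r_bounded r C -> C p -> C q -> edist p q = r -> Bdry C p.
Proof.
move=> r_gt0 /r_boundedP bC Cp Cq pq; split; first exact: subset_closure.
rewrite /interior => Cnear.
have cvp : (fun e : R => p + e *: (p - q)) @ (0:R)^'+ --> p.
  rewrite -{3}(addr0 p) -(scale0r (p - q)).
  apply: cvgD; first exact: cvg_cst.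
  apply: cvgZr_tmp; apply: cvg_at_right_filter; exact: cvg_id.
have /filter_ex [e [Ce e_gt0]] :
    \forall e \near (0:R)^'+, C (p + e *: (p - q)) /\ 0 < e.
  near=> e; split; last by near: e; exact: nbhs_right_gt.
  by near: e; exact: cvp.
have := bC _ _ Ce Cq; rewrite leNgt => /negP; apply.
rewrite /edist addrAC -[X in X + _]scale1r -scalerDl enormZ.
have -> : enorm (p - q) = r by [].
by rewrite ger0_norm ?addr_ge0 ?ltW // mulrDl mul1r ltrDl mulr_gt0.
Unshelve. all: by end_near. Qed.

End EuclideanPlane.

(** * Derivatives within an interval *)

Section WithinInterval.
Variables (R : realType) (I : set R).
Implicit Types (f : R -> R * R) (t : R).

Lemma cvg_fst_comp (F : set_system R) {FF : Filter F} f (l : R * R) :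
  f @ F --> l -> (fun s => (f s).1) @ F --> l.1.
Proof. by move=> fl; apply: cvg_comp fl _; exact: cvg_fst. Qed.

Lemma cvg_snd_comp (F : set_system R) {FF : Filter F} f (l : R * R) :
  f @ F --> l -> (fun s => (f s).2) @ F --> l.2.
Proof. by move=> fl; apply: cvg_comp fl _; exact: cvg_snd. Qed.

Lemma derivable_in_continuous f t : I t ->
  derivable_in I f t -> f @ within I (nbhs t) --> f t.
Proof.
move=> It df.
(* Away from [t], [f s] is [f t] plus [s - t] times the difference quotient. *)
have cf' : (f s) @[s --> within I t^'] --> f t.
  have -> : f t = 0 *: derive_in I f t + f t by rewrite scale0r add0r.
  apply: (@cvg_trans _
    ((fun s => (s - t) *: ((s - t)^-1 *: (f s - f t)) + f t) @ within I t^')).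
    apply: near_eq_cvg; rewrite near_withinE /=; near=> s => _ /=.
    rewrite scalerA mulfV ?scale1r ?subrK // subr_eq0.
    by near: s; exact: nbhs_dnbhs_neq.
  apply: cvgD; last exact: cvg_cst.
  apply: cvgZ; last exact: df.
  rewrite -(subrr t); apply: cvgB; last exact: cvg_cst.
  apply: cvg_trans (cvg_within _) _.
  exact: nbhs_dnbhs.
move=> U Uft.
have : \forall s \near t, s != t -> I s -> U (f s) by exact: cf' Uft.
move=> nU; change (\forall s \near t, I s -> U (f s)).
near=> s; have [-> _|st Is] := eqVneq s t; first exact: nbhs_singleton.
by move: st Is; near: s; exact: nU.
Unshelve. all: by end_near. Qed.

Lemma is_derive_of_cvg (h : R -> R) t (l : R) :
  (s - t)^-1 * (h s - h t) @[s --> t^'] --> l -> is_derive t 1 h l.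
Proof.
move=> hl; apply/is_derive1_caratheodory.
exists (fun s => if s == t then l else (s - t)^-1 * (h s - h t)).
rewrite eqxx; split=> //.
  move=> s; case: eqVneq => [->|st]; first by rewrite !subrr mulr0.
  by rewrite mulrAC mulVf ?mul1r // subr_eq0.
apply/continuous_withinNx => /=; rewrite eqxx.
apply: cvg_trans hl; apply: near_eq_cvg; near=> s.
rewrite ifN_eq //; near: s; exact: nbhs_dnbhs_neq.
Unshelve. all: by end_near. Qed.

Lemma cvg_quotient_interior f t : I° t -> derivable_in I f t ->
  (s - t)^-1 *: (f s - f t) @[s --> t^'] --> derive_in I f t.
Proof.
move=> It df; apply: cvg_trans df => U /= HU.
have It' : t^' I by exact: nbhs_dnbhs.
by apply: filterS2 It' HU => s /= Is; apply.
Qed.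

Lemma is_derive_fst f t : I° t -> derivable_in I f t ->
  is_derive t 1 (fun s => (f s).1) (derive_in I f t).1.
Proof.
move=> It df; apply: is_derive_of_cvg.
exact: (cvg_fst_comp (cvg_quotient_interior It df)).
Qed.

Lemma is_derive_snd f t : I° t -> derivable_in I f t ->
  is_derive t 1 (fun s => (f s).2) (derive_in I f t).2.
Proof.
move=> It df; apply: is_derive_of_cvg.
exact: (cvg_snd_comp (cvg_quotient_interior It df)).
Qed.

(** The mean value theorem on an interval that may contain its endpoints, for
    [a] and [b] in either order; [0 <= (c - a) * (b - c)] is an
    orientation-free way to say that [c] lies between [a] and [b]. *)
Lemma MVT_in (h dh : R -> R) a b : is_interval I -> I a -> I b ->
  (forall t, I t -> h @ within I (nbhs t) --> h t) ->
  (forall t, I° t -> is_derive t 1 h (dh t)) ->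
  exists c, [/\ I c, 0 <= (c - a) * (b - c) & h b - h a = dh c * (b - a)].
Proof.
move=> itvI Ia Ib hc hd.
wlog ab : a b Ia Ib / a <= b.
  move=> W; have [ab|ba] := leP a b; first exact: W.
  have [c [Ic cab E]] := W _ _ Ib Ia (ltW ba).
  exists c; split=> //; first by move: cab; congr (0 <= _); ring.
  by rewrite -opprB E; ring.
have abI : `[a, b] `<=` I.
  by move=> x /=; rewrite in_itv /= => axb; exact: itvI axb.
have [||c] := @MVT_segment _ h dh a b ab.
- move=> x xab; apply: hd; rewrite /interior /=.
  apply: filterS (near_in_itvoo xab) => y yab; apply: abI.
  exact: subset_itv_oo_cc yab.
- apply: (continuous_subspaceW abI); apply/subspace_continuousP; exact: hc.
rewrite in_itv /= => /andP[ac cb] E; exists c; split=> //.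
  by apply: abI; rewrite /= in_itv /= ac.
by rewrite mulr_ge0 // subr_ge0.
Qed.

Lemma interval_piece t (P : set R) : is_interval I ->
  (\forall s \near within I (nbhs t), P s) ->
  exists J, [/\ is_interval J, J `<=` I, within I (nbhs t) J & J `<=` P].
Proof.
move=> itvI [e /= e_gt0 H]; exists (I `&` ball t e); split.
- move=> x y [Ix xb] [Iy yb] z xzy; split; first exact: itvI xzy.
  move: xb yb xzy; rewrite -!ball_normE /= !ltr_norml.
  by move=> /andP[? ?] /andP[? ?] /andP[? ?]; apply/andP; split; lra.
- by move=> s [].
- by exists e => //= s sb Is.
- by move=> s [Is sb]; exact: H.
Qed.

End WithinInterval.

(** * Derivatives of the expressions that define the parallel curve *)

Section RealDerivatives.
Variable R : realType.
Implicit Types (x y : R -> R) (t : R).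

Lemma is_derive_add x y t dx dy :
  is_derive t 1 x dx -> is_derive t 1 y dy ->
  is_derive t 1 (fun s => x s + y s) (dx + dy).
Proof. exact: is_deriveD. Qed.

Lemma is_derive_mul x y t dx dy :
  is_derive t 1 x dx -> is_derive t 1 y dy ->
  is_derive t 1 (fun s => x s * y s) (x t * dy + y t * dx).
Proof. exact: is_deriveM. Qed.

Lemma is_derive_affine x t (c b dx : R) :
  is_derive t 1 x dx -> is_derive t 1 (fun s => b + c * x s) (c * dx).
Proof.
move=> hx; rewrite -[c * dx]add0r; exact: is_derive_add (is_deriveZ c hx).
Qed.

Lemma is_derive_enormV (x y : R -> R) t dx dy : 0 < enorm (x t, y t) ->
  is_derive t 1 x dx -> is_derive t 1 y dy ->
  is_derive t 1 (fun s => (enorm (x s, y s))^-1)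
    (- (x t * dx + y t * dy) / enorm (x t, y t) ^+ 3).
Proof.
move=> n_gt0 hx hy.
have q_gt0 : 0 < x t * x t + y t * y t by rewrite -sqrtr_gt0 -!expr2.
have hq := is_derive_add (is_derive_mul hx hx) (is_derive_mul hy hy).
have hn := @is_derive1_comp _ Num.sqrt (fun s => x s * x s + y s * y s) _ _ _
  (is_derive1_sqrt q_gt0) hq.
have E s : enorm (x s, y s) = Num.sqrt (x s * x s + y s * y s).
  by rewrite /enorm /= !expr2.
under eq_fun do rewrite E; rewrite E in n_gt0 *.
have n_neq0 : Num.sqrt (x t * x t + y t * y t) != 0 by rewrite gt_eqF.
have hV := @is_deriveV _ (fun s => Num.sqrt (x s * x s + y s * y s)) _ _ _
  n_neq0 hn.
apply: (is_derive_eq hV).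
rewrite /GRing.scale /=; move: n_neq0; set n := Num.sqrt _ => n_neq0.
by field.
Qed.

End RealDerivatives.

(** * The parallel curve *)

Section ParallelCurve.
Variables (R : realType) (I : set R) (g : R -> R * R).
Implicit Types (J : set R) (d s t : R).

Let v := derive_in I g.
Let a := derive_in I v.

(** The signed offset [d] multiplies the left unit normal, so one definition
    serves both signs of the curvature. *)
Definition parallel_curve d t : R * R :=
  g t + (d / enorm (v t)) *: (- (v t).2, (v t).1).

Section AtAPoint.
Variables (d t : R).
Hypotheses (It : I° t) (dg : derivable_in I g t) (dv : derivable_in I v t).
Hypothesis v_neq0 : v t != 0.

Let n_gt0 : 0 < enorm (v t) := enorm_gt0 v_neq0.

(* With this form of [1 / |v|], all terms of the derivative of the unit normal
   have the denominator [|v| ^ 3] of the curvature. *)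
Let invnE : (enorm (v t))^-1 =
  ((v t).1 * (v t).1 + (v t).2 * (v t).2) / enorm (v t) ^+ 3.
Proof.
have := sqr_enorm (v t); rewrite /dot => <-.
by have := gt_eqF n_gt0; set n := enorm _ => n0; field; rewrite n0.
Qed.

Let hVn : is_derive t 1 (fun s => (enorm (v s))^-1)
  (- dot (v t) (a t) / enorm (v t) ^+ 3).
Proof.
have E s : enorm (v s) = enorm ((v s).1, (v s).2) by [].
under eq_fun do rewrite E; rewrite E.
exact: (is_derive_enormV _ (is_derive_fst It dv) (is_derive_snd It dv)).
Qed.

(** The derivative of the left unit normal is [- kappa v]: the part of [a] along
    [v] only changes the speed, and the remaining part is [kappa |v| ^ 2] times
    the left unit normal. *)
Lemma is_derive_parallel_fst : is_derive t 1
  (fun s => (parallel_curve d s).1) ((1 - d * curvature I g t) * (v t).1).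
Proof.
have H := is_derive_add (is_derive_fst It dg)
  (is_derive_affine (- d) 0 (is_derive_mul hVn (is_derive_snd It dv))).
have -> : (fun s => (parallel_curve d s).1) =
    (fun s => (g s).1 + (0 + - d * ((enorm (v s))^-1 * (v s).2))).
  by apply/funext => s; rewrite /= /GRing.scale /=; ring.
apply: (is_derive_eq H); rewrite invnE /curvature -/v -/a /dot.
have := gt_eqF n_gt0; set n := enorm _ => n0.
by field; rewrite n0.
Qed.

Lemma is_derive_parallel_snd : is_derive t 1
  (fun s => (parallel_curve d s).2) ((1 - d * curvature I g t) * (v t).2).
Proof.
have H := is_derive_add (is_derive_snd It dg)
  (is_derive_affine d 0 (is_derive_mul hVn (is_derive_fst It dv))).
have -> : (fun s => (parallel_curve d s).2) =
    (fun s => (g s).2 + (0 + d * ((enorm (v s))^-1 * (v s).1))).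
  by apply/funext => s; rewrite /= /GRing.scale /=; ring.
apply: (is_derive_eq H); rewrite invnE /curvature -/v -/a /dot.
have := gt_eqF n_gt0; set n := enorm _ => n0.
by field; rewrite n0.
Qed.

End AtAPoint.

Lemma edist_parallel d t : v t != 0 -> edist (g t) (parallel_curve d t) = `|d|.
Proof.
move=> /enorm_gt0; rewrite /edist /parallel_curve opprD addNKr -scaleNr enormZ.
have -> : enorm (- (v t).2, (v t).1) = enorm (v t).
  by rewrite /enorm /= sqrrN addrC.
move=> n_gt0; rewrite normrN normrM normfV [`|enorm _|]ger0_norm ?ltW //.
by rewrite divfK // gt_eqF.
Qed.

Lemma cvg_parallel d t : I t -> derivable_in I g t -> derivable_in I v t ->
  v t != 0 ->
  parallel_curve d @ within I (nbhs t) --> parallel_curve d t.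
Proof.
move=> It dg dv v_neq0.
have cg := derivable_in_continuous It dg.
have cv := derivable_in_continuous It dv.
have cx : (fun s => (v s).1) @ within I (nbhs t) --> (v t).1.
  exact: cvg_fst_comp cv.
have cy : (fun s => (v s).2) @ within I (nbhs t) --> (v t).2.
  exact: cvg_snd_comp cv.
apply: cvgD; first exact: cg.
apply: cvgZ.
  apply: cvgM; first exact: cvg_cst.
  apply: cvgV; first by rewrite gt_eqF ?enorm_gt0.
  have cq : (fun s => dot (v s) (v s)) @ within I (nbhs t) --> dot (v t) (v t).
    by apply: cvgD; apply: cvgM.
  rewrite enormE; under [X in X @ _]eq_fun do rewrite enormE.
  exact: (cvg_comp _ _ cq (@sqrt_continuous R _)).
exact: (cvg_pair (cvgN cy) cx).
Qed.

(** Inside [J], the tangents make no obtuse angle and [d] has the sign of the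
    curvature, with [|d|] at least the radius of curvature. *)
Section LocalDisc.
Variables (J : set R) (d : R).
Hypotheses (JI : J `<=` I) (itvJ : is_interval J).
Hypothesis dg : forall t, J t -> derivable_in I g t.
Hypothesis dv : forall t, J t -> derivable_in I v t.
Hypothesis v_neq0 : forall t, J t -> v t != 0.
Hypothesis v_turn : forall s t, J s -> J t -> 0 <= dot (v s) (v t).
Hypothesis curv : forall t, J t -> 1 <= d * curvature I g t.

Let cvgJ (f : R -> R) t (l : R) : f @ within I (nbhs t) --> l ->
  f @ within J (nbhs t) --> l.
Proof.
move=> fl; apply: cvg_trans fl => U /= [e e_gt0 H]; exists e => // s Hs Js.
by apply: H => //; exact: JI.
Qed.

Let cvgJ_fst (f : R -> R * R) t : f @ within I (nbhs t) --> f t ->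
  (fun s => (f s).1) @ within J (nbhs t) --> (f t).1.
Proof. by move=> fl; apply: cvgJ; exact: cvg_fst_comp fl. Qed.

Let cvgJ_snd (f : R -> R * R) t : f @ within I (nbhs t) --> f t ->
  (fun s => (f s).2) @ within J (nbhs t) --> (f t).2.
Proof. by move=> fl; apply: cvgJ; exact: cvg_snd_comp fl. Qed.

(** The mean value theorem for [u |-> <g u, v t>], whose derivative [<v u, v t>]
    is nonnegative. *)
Lemma chord_dot_tangent s t : J s -> J t ->
  exists2 k, 0 <= k & dot (g s - g t) (v t) = k * (s - t).
Proof.
move=> Js Jt.
pose h u := (v t).1 * (g u).1 + (v t).2 * (g u).2.
have [u Ju|u Ju|c [Jc _ E]] :=
  @MVT_in R J h (fun u => dot (v u) (v t)) t s itvJ Jt Js.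
- have cg := derivable_in_continuous (JI Ju) (dg Ju).
  by apply: cvgD; (apply: cvgM; first exact: cvg_cst);
    [exact: cvgJ_fst|exact: cvgJ_snd].
- have Iu : I° u by exact: interiorS Ju.
  have Ju' : J u by exact: interior_subset.
  have H := is_derive_add
    (is_derive_affine (v t).1 0 (is_derive_fst Iu (dg Ju')))
    (is_derive_affine (v t).2 0 (is_derive_snd Iu (dg Ju'))).
  have -> : h = fun u => 0 + (v t).1 * (g u).1 + (0 + (v t).2 * (g u).2).
    by apply/funext => w; rewrite /h !add0r.
  by apply: (is_derive_eq H); rewrite /dot /v; ring.
- exists (dot (v c) (v t)); first exact: v_turn.
  by rewrite -E /h /dot /=; ring.
Qed.

(** The curve stays in the disc of radius [|d|] that is tangent to it at [g t]
    on the side of the centre of curvature.  As a function of [t], the squared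
    distance from [g s] to the centre [parallel_curve d t] has a derivative of
    the sign of [s - t], so it is maximal at [t = s]. *)
Lemma edist_parallel_le s t : J s -> J t ->
  edist (g s) (parallel_curve d t) <= `|d|.
Proof.
move=> Js Jt; rewrite enorm_le //.
rewrite -(edist_parallel d (v_neq0 Js)) sqr_enorm.
pose e := parallel_curve d.
pose h u := ((g s).1 + (-1) * (e u).1) * ((g s).1 + (-1) * (e u).1)
          + ((g s).2 + (-1) * (e u).2) * ((g s).2 + (-1) * (e u).2).
have hE u :
    dot (g s - parallel_curve d u) (g s - parallel_curve d u) = h u.
  by rewrite /dot /h /e /= !mulN1r.
suff: 0 <= h s - h t by rewrite subr_ge0 -(hE s) -(hE t).
pose dh u := 2 * (d * curvature I g u - 1) * dot (g s - g u) (v u).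
have [u Ju|u Ju|c [Jc cst E]] := @MVT_in R J h dh t s itvJ Jt Js.
- have ce := cvg_parallel (d := d) (JI Ju) (dg Ju) (dv Ju) (v_neq0 Ju).
  have ce1 := cvgJ_fst ce; have ce2 := cvgJ_snd ce.
  have cvg_sqr (c : R) (x : R -> R) (l : R) : x @ within J (nbhs u) --> l ->
      (fun w => (c + (-1) * x w) * (c + (-1) * x w)) @ within J (nbhs u) -->
      (c + (-1) * l) * (c + (-1) * l).
    move=> xl; have cxl : (fun w => c + (-1) * x w) @ within J (nbhs u) -->
        c + (-1) * l.
      by apply: cvgD; [exact: cvg_cst|apply: cvgM => //; exact: cvg_cst].
    exact: (cvgM cxl cxl).
  exact: (cvgD (cvg_sqr _ _ _ ce1) (cvg_sqr _ _ _ ce2)).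
- have Iu : I° u by exact: interiorS Ju.
  have Ju' : J u by exact: interior_subset.
  have H1 := is_derive_affine (-1) (g s).1
    (is_derive_parallel_fst d Iu (dg Ju') (dv Ju') (v_neq0 Ju')).
  have H2 := is_derive_affine (-1) (g s).2
    (is_derive_parallel_snd d Iu (dg Ju') (dv Ju') (v_neq0 Ju')).
  have H := is_derive_add (is_derive_mul H1 H1) (is_derive_mul H2 H2).
  apply: (is_derive_eq H).
  (* The contribution of the normal vector [e u - g u], orthogonal to [v u],
     cancels. *)
  by rewrite /dh /dot /e /parallel_curve /= /GRing.scale /=; ring.
rewrite E /dh; have [k k_ge0 ->] := chord_dot_tangent Js Jc.
(* [c] lies between [s] and [t], so [s - c] and [s - t] have the same sign. *)
have -> : 2 * (d * curvature I g c - 1) * (k * (s - c)) * (s - t)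
  = 2 * (d * curvature I g c - 1) * k * ((s - c) * (s - t)) by ring.
apply: mulr_ge0.
  by rewrite mulr_ge0 // mulr_ge0 // subr_ge0 curv.
have -> : (s - c) * (s - t) = (s - c) ^+ 2 + (c - t) * (s - c) by ring.
by rewrite addr_ge0 // sqr_ge0.
Qed.

End LocalDisc.
End ParallelCurve.

(** * Short pieces lie in the boundary of a maximal set *)

Theorem theorem0p5 (R : realType) (r : R) (I : set R) (gamma : R -> R * R)
    (r_gt0 : 0 < r)
    (I_itv : is_interval I) (I_pos : positive_length I)
    (gamma_C2 : C2_curve I gamma) (gamma_reg : regular_curve I gamma)
    (kappa_neq0 : forall t, I t -> curvature I gamma t != 0)
    (radius_le : forall t, I t -> 1 / `|curvature I gamma t| <= r) :
  forall t0 : R, I t0 ->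
    exists J : set R,
      [/\ J `<=` I, within I (nbhs t0) J &
          exists C : set (R * R), r_maximal r C /\ gamma @` J `<=` Bdry C].
Proof.
move=> t0 It0; case: gamma_C2 => dg dv ca.
pose v := derive_in I gamma; pose a := derive_in I v.
pose F := within I (nbhs t0).
have FF : Filter F by exact: within_filter.
have cg : gamma @ F --> gamma t0 by exact: derivable_in_continuous (dg _ It0).
have cv : v @ F --> v t0 by exact: derivable_in_continuous (dv _ It0).
have caF : a @ F --> a t0.
  by move/subspace_continuousP: ca; apply.
(* The sign puts the parallel curve on the side of the centre of curvature. *)
pose d := r * Num.sg (curvature I gamma t0).
have d_norm : `|d| = r.
  by rewrite normrM normr_sg kappa_neq0 // mulr1 gtr0_norm.
pose e := parallel_curve I gamma d.
have ce : e @ F --> e t0.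
  exact: (cvg_parallel (d := d) It0 (dg _ It0) (dv _ It0) (gamma_reg _ It0)).
have cg1 : (fun s => (gamma s).1) @ F --> (gamma t0).1.
  exact: cvg_fst_comp cg.
have cg2 : (fun s => (gamma s).2) @ F --> (gamma t0).2.
  exact: cvg_snd_comp cg.
have ce1 : (fun s => (e s).1) @ F --> (e t0).1.
  exact: cvg_fst_comp ce.
have ce2 : (fun s => (e s).2) @ F --> (e t0).2.
  exact: cvg_snd_comp ce.
have cv1 : (fun s => (v s).1) @ F --> (v t0).1.
  exact: cvg_fst_comp cv.
have cv2 : (fun s => (v s).2) @ F --> (v t0).2.
  exact: cvg_snd_comp cv.
have ca1 : (fun s => (a s).1) @ F --> (a t0).1.
  exact: cvg_fst_comp caF.
have ca2 : (fun s => (a s).2) @ F --> (a t0).2.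
  exact: cvg_snd_comp caF.
have ck : (fun s => d * cross (v s) (a s)) @ F --> d * cross (v t0) (a t0).
  exact: (cvgM (cvg_cst d) (cvgB (cvgM cv1 ca2) (cvgM cv2 ca1))).
have cross0 : (fun s => `|cross (v s) (v t0)|) @ F --> (0 : R).
  rewrite -(normr0 R) -(crossvv (v t0)); apply: cvg_norm.
  exact: (cvgB (cvgM cv1 (cvg_cst _)) (cvgM cv2 (cvg_cst _))).
have dot0 : (fun s => dot (v s) (v t0)) @ F --> dot (v t0) (v t0).
  exact: (cvgD (cvgM cv1 (cvg_cst _)) (cvgM cv2 (cvg_cst _))).
(* A tangent near [v t0] is in the sector of half-angle [pi/4] around [v t0]. *)
have csec : (fun s => dot (v s) (v t0) - `|cross (v s) (v t0)|) @ F -->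
    dot (v t0) (v t0).
  by rewrite -[dot (v t0) (v t0)]subr0; exact: (cvgB dot0 cross0).
have signk t : I t ->
    (0 < d * cross (v t) (a t)) = (0 < d * curvature I gamma t).
  move=> It; rewrite /curvature -/v -/a -/(cross _ _) mulrA.
  by rewrite [RHS]pmulr_lgt0 // invr_gt0 exprn_gt0 // enorm_gt0 // gamma_reg.
(* [edist_le_small] turns a coordinatewise bound [r / 4] into the bound [r]. *)
pose small (x y : R) := `|x - y| <= r / 4.
have r4 : 0 < r / 4 by rewrite divr_gt0.
pose P t := [/\
  [/\ small (gamma t).1 (gamma t0).1 & small (gamma t).2 (gamma t0).2],
  [/\ small (e t).1 (e t0).1 & small (e t).2 (e t0).2],
  `|cross (v t) (v t0)| <= dot (v t) (v t0) &
  0 < d * cross (v t) (a t)].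
have nearP : \forall t \near F, P t.
  have near_small (x : R -> R) l :
      x @ F --> l -> \forall t \near F, small (x t) l.
    by move=> xl; exact: (cvgr_distC_le _ _ xl _ r4).
  have n1 := near_small _ _ cg1; have n2 := near_small _ _ cg2.
  have n3 := near_small _ _ ce1; have n4 := near_small _ _ ce2.
  have n5 := cvgr_gt _ csec _ (dot_gt0 (gamma_reg _ It0)).
  have n6 : \forall t \near F, 0 < d * cross (v t) (a t).
    apply: (cvgr_gt _ ck); rewrite signk // /d -mulrA -normrEsg mulr_gt0 //.
    by rewrite normr_gt0 kappa_neq0.
  near=> t; split.
  - by split; near: t; [exact: n1|exact: n2].
  - by split; near: t; [exact: n3|exact: n4].
  - by rewrite -subr_ge0; apply: ltW; near: t; exact: n5.
  - by near: t; exact: n6.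
have [J [itvJ JI nearJ JP]] := interval_piece I_itv nearP.
exists J; split=> //.
have v_turn s t : J s -> J t -> 0 <= dot (v s) (v t).
  move=> /JP[_ _ sv _] /JP[_ _ tv _].
  exact: dot_ge0_of_sector sv tv (gamma_reg _ It0).
have curv t : J t -> 1 <= d * curvature I gamma t.
  move=> Jt; have It := JI _ Jt.
  have [_ _ _] := JP _ Jt; rewrite signk // => dk.
  rewrite -(gtr0_norm dk) normrM d_norm -ler_pdivrMr ?normr_gt0 ?kappa_neq0 //.
  exact: radius_le.
have gamma_e s t : J s -> J t -> edist (gamma s) (e t) <= r.
  move=> Js Jt; have dgJ u (Ju : J u) := dg u (JI u Ju).
  have dvJ u (Ju : J u) := dv u (JI u Ju).
  have regJ u (Ju : J u) := gamma_reg _ (JI u Ju).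
  have := edist_parallel_le JI itvJ dgJ dvJ regJ v_turn curv Js Jt.
  by rewrite d_norm.
have r44 : 4 * (r / 4) = r by field.
have [C [Cmax AC]] : exists C, r_maximal r C /\ gamma @` J `|` e @` J `<=` C.
  apply: r_maximal_extension; apply/r_boundedP => p q.
  move=> [[s Js <-]|[s Js <-]] [[t Jt <-]|[t Jt <-]].
  - have [[s1 s2] _ _ _] := JP _ Js; have [[t1 t2] _ _ _] := JP _ Jt.
    by have := edist_le_small s1 s2 t1 t2; rewrite r44.
  - exact: gamma_e.
  - by rewrite edistC; exact: gamma_e.
  - have [_ [s1 s2] _ _] := JP _ Js; have [_ [t1 t2] _ _] := JP _ Jt.
    by have := edist_le_small s1 s2 t1 t2; rewrite r44.
exists C; split=> // _ [t Jt <-].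
apply: (diameter_end_Bdry (q := e t) r_gt0 Cmax.1).
- by apply: AC; left; exists t.
- by apply: AC; right; exists t.
- by rewrite edist_parallel ?d_norm //; exact: gamma_reg _ (JI _ Jt).
Unshelve. all: by end_near. Qed.
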